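(* Let $G$ be a right partially ordered group or a left partially ordered group, with identity $e$ and positive cone $G^+ = \{x\in G : x > e\}$. Let $\mathcal{J}$ be the set of all downward closed nonempty finite subsets of $G^+$, and for $A \subseteq G^+$ let $\sigma_{\mathcal{J}}(A) = \inf\{ |A\cap J|/|J| : J \in \mathcal{J}\}$. Let $A$ and $B$ be subsets of $G^+$ with $\sigma_{\mathcal{J}}(A) = \alpha$ and $\sigma_{\mathcal{J}}(B) = \beta$. Suppose that for every $J \in \mathcal{J}$ and every $x \in J \setminus B$ the set $B^*(x) = \{b \in B : b < x\} = B \cap (e,x)$ is nonempty and finite. Then: (i) if $G$ is right partially ordered, $\sigma_{\mathcal{J}}(AB) \ge \alpha + \beta - \alpha\beta$; (ii) if $G$ is left partially ordered, $\sigma_{\mathcal{J}}(BA) \ge \alpha + \beta - \alpha\beta$. Here $AB = \{ab : a \in A \cup\{e\},\ b \in B\cup\{e\}\}$ and $BA = \{ba : b \in B \cup\{e\},\ a \in A\cup\{e\}\}$, and $\sigma_{\mathcal J}$ of a set containing $e$ is defined by the same formula.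
   Context: A group $G$ with a partial order $\le$ is right partially ordered if $a \le b$ implies $ac \le bc$ for all $a,b,c\in G$, and left partially ordered if $a\le b$ implies $ca \le cb$ for all $a,b,c \in G$. We write $x<y$ if $x\le y$ and $x\ne y$. For $x \in G$, $(e,x) = \{y \in G : e < y < x\}$. A subset $J \subseteq G^+$ is downward closed if $x \in J$ implies $(e,x) \subseteq J$. *)

(* Defs.v *)
From HB Require Import structures.
From mathcomp Require Import all_boot all_order all_algebra finmap.
From mathcomp Require Import boolp classical_sets functions cardinality reals.

Set Implicit Arguments.
Unset Strict Implicit.
Unset Printing Implicit Defensive.

Import Order.TTheory GRing.Theory Num.Theory.

Local Open Scope classical_set_scope.
Local Open Scope ring_scope.

(* A possibly infinite group that also carries a partial order, with no
   compatibility assumed between the two; compatibility is one of the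
   predicates [right_partially_ordered], [left_partially_ordered]. *)
#[short(type="porderedGroupType")]
HB.structure Definition POrderedGroup (d : Order.disp_t) :=
  {G of Group G & Order.POrder d G}.

Definition right_partially_ordered d (G : porderedGroupType d) : Prop :=
  forall a b c : G, (a <= b)%O -> (a * c <= b * c)%g%O.

Definition left_partially_ordered d (G : porderedGroupType d) : Prop :=
  forall a b c : G, (a <= b)%O -> (c * a <= c * b)%g%O.

Section Density.
Context {d : Order.disp_t} {G : porderedGroupType d}.
Implicit Types (A B J : set G) (x : G).

Definition positive_cone : set G := [set x | (1%g < x)%O].

Definition open_from_one x : set G := [set y | (1%g < y)%O /\ (y < x)%O].

Definition downward_closed J : Prop :=
  forall x, J x -> open_from_one x `<=` J.

Definition downsets : set (set G) :=
  [set J | [/\ J `<=` positive_cone, J !=set0, finite_set J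
             & downward_closed J]].

(* When [downsets] is empty the infimum is over the empty set and [inf]
   returns 0. *)
Definition density (R : realType) A : R :=
  inf [set (#|` fset_set (A `&` J)|%:R / #|` fset_set J|%:R : R)
      | J in downsets].

Definition strictly_below B x : set G := [set b | B b /\ (b < x)%O].

Definition product_with_one A B : set G :=
  [set (a * b)%g | a in A `|` [set 1%g] & b in B `|` [set 1%g]].

End Density.

Arguments positive_cone {d} G.
Arguments downsets {d} G.

(* Main.v *)
(** Let [J] be a finite down-set and [x] in [J \ B]. Pick [b] maximal among the
    elements of [B] lying in [J]: the elements of [J \ B] above [b], divided by
    [b], form a finite down-set, in which [A] therefore has proportion at least
    [alpha]. Removing [b] and these elements and iterating exhausts [J \ B], so
    that [|AB /\ J| >= |B /\ J| + alpha |J \ B|], while [|B /\ J| >= beta |J|]. *)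
Require Import Defs.
From mathcomp Require Import all_boot all_order all_algebra.
From mathcomp Require Import boolp classical_sets cardinality reals.
From mathcomp Require Import finmap lra.

Local Open Scope classical_set_scope.
Local Open Scope ring_scope.

Import Order.TTheory GRing.Theory Num.Theory.

Lemma exists_maximal_fset (d : Order.disp_t) (T : porderType d) (S : {fset T}) :
  S != fset0 -> exists2 m, m \in S & forall y, y \in S -> ~~ (m < y)%O.
Proof.
elim/fset1U_rect: S => [|x S _ IH _]; first by rewrite eqxx.
have [->|/IH [m mS mmax]] := eqVneq (S : {fset T}) fset0.
  exists x; first by rewrite !inE eqxx.
  by move=> y; rewrite !inE orbF => /eqP ->; rewrite ltxx.
(* If the new element exceeds [m] it is maximal itself, by transitivity; otherwise [m] stays
   maximal. *)
have [mx|mx] := boolP (m < x)%O; last first.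
  exists m; first by rewrite !inE mS orbT.
  by move=> y; rewrite !inE => /orP[/eqP -> //|]; exact: mmax.
exists x; first by rewrite !inE eqxx.
move=> y; rewrite !inE => /orP[/eqP ->|/mmax]; first by rewrite ltxx.
by apply: contra; exact: lt_trans.
Qed.

Section Density.
Context (R : realType) (d : Order.disp_t) (G : porderedGroupType d).
Implicit Types (A B J : set G) (F S U : {fset G}).

Notation "F `!` A" := [fset x in F | `[< A x >]]%fset (at level 40).

Definition is_downset F :=
  (forall x, x \in F -> (1%g < x)%O) /\
  (forall x y, x \in F -> (1%g < y)%O -> (y < x)%O -> y \in F).

Lemma fset_setI_restrict A F : fset_set (A `&` [set` F]) = F `!` A.
Proof.
apply/fsetP => x; rewrite in_fset_set; last exact/finite_setIr/finite_fset.
rewrite !inE; apply/idP/andP.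
  by rewrite in_setE => -[Ax xF]; split => //; exact/asboolP.
by move=> [xF /asboolP Ax]; rewrite in_setE.
Qed.

Lemma density_has_lbound A :
  has_lbound [set (#|` fset_set (A `&` J)|%:R / #|` fset_set J|%:R : R)
             | J in downsets G].
Proof. by exists 0 => _ [J _ <-]; rewrite divr_ge0. Qed.

Lemma downsets_fset F : is_downset F -> F != fset0 -> downsets G [set` F].
Proof.
move=> [Fpos Fdown] /fset0Pn [x xF]; split; first exact: Fpos.
- by exists x.
- exact: finite_fset.
- by move=> y yF z [z1 zy]; exact: Fdown zy.
Qed.

Lemma downsetsP J : downsets G J ->
  exists F, [/\ J = [set` F], is_downset F & F != fset0].
Proof.
move=> [Jpos [x Jx] /finite_fsetP [F JF] Jdown]; subst J.
exists F; split => //; last by apply/fset0Pn; exists x.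
by split => [y /Jpos //|y z yF z1 zy]; apply: (Jdown y).
Qed.

(** With the denominator cleared, the bound also covers the empty set. *)
Lemma density_le_card A F : is_downset F ->
  density R A * #|` F|%:R <= #|` F `!` A|%:R.
Proof.
move=> Fdown; have [->|F0] := eqVneq F fset0.
  by rewrite cardfs0 mulr0.
rewrite -ler_pdivlMr ?ltr0n ?cardfs_gt0 //.
apply: inf_lbound; first exact: density_has_lbound.
exists [set` F]; first exact: downsets_fset.
by rewrite fset_setI_restrict set_fsetK.
Qed.

(** Nonemptiness guards against the default value [0] of [inf] on the empty set, which a positive
    [c] would exceed. *)
Lemma density_ge A (c : R) : downsets G !=set0 ->
  (forall F, is_downset F -> F != fset0 -> c * #|` F|%:R <= #|` F `!` A|%:R) ->
  c <= density R A.
Proof.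
move=> [J0 J0d] hc; apply: lb_le_inf; first by eexists; exists J0.
move=> _ [_ /downsetsP [F [-> Fd F0]] <-].
by rewrite fset_setI_restrict set_fsetK ler_pdivlMr ?ltr0n ?cardfs_gt0 // hc.
Qed.

Lemma density_no_downset A : ~ (downsets G !=set0) -> density R A = 0.
Proof.
move=> nd; rewrite /density (_ : [set _ | _ in _] = set0) ?inf0 //.
by apply/seteqP; split => // y [J Jd _]; case: nd; exists J.
Qed.

(** Any single down-set gives a ratio at most 1, and without one the value is [0]. The final
    inequality uses this as [1 - density R A >= 0]. *)
Lemma density_le1 A : density R A <= 1.
Proof.
have [[J /downsetsP [F [_ Fd F0]]]|nd] := pselect (downsets G !=set0).
  have := density_le_card A _ Fd; rewrite -ler_pdivlMr ?ltr0n ?cardfs_gt0 //.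
  move=> /le_trans; apply; rewrite ler_pdivrMr ?ltr0n ?cardfs_gt0 // mul1r.
  by rewrite ler_nat fsubset_leq_card //; apply/fsubsetP => x; rewrite !inE => /andP[].
by rewrite density_no_downset.
Qed.

Section OneSidedOrder.
(* [op a b] stands for [a * b] under a right order and for [b * a] under a left
   order; [quo] is the corresponding quotient. *)
Variables (op quo : G -> G -> G).
Hypotheses (opK : forall b, cancel (op^~ b) (quo^~ b))
           (quoK : forall b, cancel (quo^~ b) (op^~ b))
           (op1 : forall b, op 1%g b = b)
           (lt_op : forall a b c, (a < b)%O -> (op a c < op b c)%O)
           (lt_quo : forall a b c, (a < b)%O -> (quo a c < quo b c)%O).

(** This is the iteration, by induction on the size of [S]. Both hypotheses survive the removal of a
    maximal [m] from [S] and of the elements above [m] from [U]; the second lets intervals from [S]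
    to [U] be filled by both sets jointly. *)
Lemma density_card_quo A S U :
  (forall x, x \in U -> exists2 b, b \in S & (b < x)%O) ->
  (forall b x y, b \in S -> x \in U -> (b < y)%O -> (y < x)%O ->
     (y \in U) || (y \in S)) ->
  density R A * #|` U|%:R <=
    #|` U `!` [set x | exists2 b, b \in S & A (quo x b)]|%:R.
Proof.
have [n] := ubnP #|` S|; elim: n => // n IH in S U * => Sn Uabove Uclosed.
have [S0|/exists_maximal_fset [m mS mmax]] := eqVneq S fset0.
  suff -> : U = fset0 by rewrite cardfs0 mulr0.
  apply/eqP; apply: contraT => /fset0Pn [x /Uabove [b]].
  by rewrite S0 inE.
pose V := [fset x in U | (m < x)%O]%fset.
pose W := (quo^~ m @` V)%fset.
have quo_inj b : injective (quo^~ b) := can_inj (quoK b).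
have quom : quo m m = 1%g by rewrite -{1}(op1 m) opK.
(* A point between [m] and an element of [V] lies in [U] or [S] by [Uclosed], and maximality of [m]
   excludes [S]. Multiplying by [m] carries a positive point below an element of [W] to such a
   point. *)
have Wdown : is_downset W.
  split => [w /imfsetP [x /=]|w y /imfsetP [x /=]]; rewrite !inE => /andP[xU mx] ->.
    by rewrite -quom; exact: lt_quo.
  move=> y1 /(lt_op _ _ m); rewrite quoK => yx.
  have my : (m < op y m)%O by rewrite -{1}(op1 m); exact: lt_op.
  apply/imfsetP; exists (op y m); last by rewrite opK.
  rewrite !inE my andbT; have := Uclosed _ _ _ mS xU my yx.
  by case/orP => // /mmax; rewrite my.
have cardW : #|` W| = #|` V| by rewrite card_imfset.
have WA := density_le_card A _ Wdown.
have UV : (#|` U| = #|` V| + #|` (U `\` V)%fset|)%N.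
  by rewrite -(cardfsID V U) (fsetIidPr _) //; apply/fsubsetP => x; rewrite !inE => /andP[].
have Sm : (#|` (S `\ m)%fset| < n)%N by move: Sn; rewrite (cardfsD1 m S) mS.
(* An element left in [U] is not above [m], so its witness in [S] differs from [m]. *)
have Uabove' x : x \in (U `\` V)%fset -> exists2 b, b \in (S `\ m)%fset & (b < x)%O.
  rewrite !inE negb_and => /andP[/orP[/negPf->//|nmx] xU].
  have [b bS bx] := Uabove _ xU; exists b => //.
  by rewrite !inE bS andbT; apply: contraNneq nmx => <-.
(* If [x] is not above [m], no [y] below [x] is above or equal to [m], so neither removal affects
   [y]. *)
have Uclosed' b x y : b \in (S `\ m)%fset -> x \in (U `\` V)%fset ->
    (b < y)%O -> (y < x)%O -> (y \in (U `\` V)%fset) || (y \in (S `\ m)%fset).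
  rewrite !inE negb_and => /andP[_ bS] /andP[/orP[/negPf->//|nmx] xU] byy yx.
  have nmy : ~~ (m < y)%O by apply: contra nmx => /lt_trans; exact.
  have ym : y != m by apply: contraNneq nmx => <-.
  by rewrite (negbTE nmy) ym andbF /=; exact: Uclosed bS xU byy yx.
have := IH _ _ Sm Uabove' Uclosed'.
set P := (X in _ <= #|` X|%:R -> _) => PA.
set Q := (X in _ <= #|` X|%:R).
(* The translates by [m] of the elements of [A] in [W] lie in [V], while [P] lies outside [V];
   nothing is counted twice. *)
have cardQ : (#|` W `!` A| + #|` P| <= #|` Q|)%N.
  have <- : #|` (op^~ m @` (W `!` A))%fset| = #|` W `!` A|.
    by rewrite card_imfset //; exact: can_inj (opK m).
  rewrite -cardfsUI.
  set X := ((op^~ m) @` _)%fset.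
  have -> : (X `&` P)%fset = fset0.
    apply/fsetP => x; rewrite [RHS]inE; apply/negP => /fsetIP[].
    move=> /imfsetP [w /=]; rewrite inE => /andP[/imfsetP[v /= vV ->] _].
    by rewrite quoK => ->; move: vV; rewrite !inE => /andP[-> ->].
  rewrite cardfs0 addn0; apply: fsubset_leq_card.
  apply/fsubsetP => x /fsetUP[].
    move=> /imfsetP [w /=]; rewrite inE => /andP[/imfsetP[v /= vV ->] /asboolP Aw].
    rewrite quoK => ->; rewrite !inE; move: vV; rewrite !inE => /andP[-> _] /=.
    by apply/asboolP; exists m.
  rewrite !inE => /andP[/andP[_ ->]] /asboolP [b].
  by rewrite !inE => /andP[_ bS] Ab; apply/asboolP; exists b.
move: cardQ; rewrite -(ler_nat R) natrD; apply: le_trans.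
by rewrite UV natrD mulrDr lerD // -cardW.
Qed.

(** [C] stands for either product set. The points of a down-set that lie in [B] all count towards
    [C], and at least a proportion [density R A] of the others does. *)
Lemma density_op A B C : B `<=` positive_cone G ->
  (forall J, downsets G J -> forall x, (J `\` B) x -> strictly_below B x !=set0) ->
  B `<=` C -> (forall a b, A a -> B b -> C (op a b)) ->
  density R A + density R B - density R A * density R B <= density R C.
Proof.
move=> Bpos Bbelow BC ABC.
(* Without any down-set all three densities take the default value [0]. *)
have [Jne|nd] := pselect (downsets G !=set0); last first.
  by rewrite !density_no_downset // mulr0 subr0 addr0.
apply: density_ge => // F Fdown F0.
pose S := F `!` B; pose U := (F `\` S)%fset.
have SF : (S `<=` F)%fset by apply/fsubsetP => x; rewrite !inE => /andP[].
have FU : (#|` F| = #|` S| + #|` U|)%N.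
  by rewrite -(cardfsID S F) (fsetIidPr SF).
have UB x : x \in U -> x \in F /\ ~ B x.
  by rewrite !inE negb_and => /andP[/orP[/negPf->//|/asboolPn ?] ?].
have Uabove x : x \in U -> exists2 b, b \in S & (b < x)%O.
  move=> /UB [xF nBx].
  have [b [Bb bx]] := Bbelow _ (downsets_fset _ Fdown F0) x (conj xF nBx).
  exists b => //; rewrite !inE; apply/andP; split; last exact/asboolP.
  exact: (Fdown.2 x b xF (Bpos _ Bb) bx).
have Uclosed b x y : b \in S -> x \in U -> (b < y)%O -> (y < x)%O ->
    (y \in U) || (y \in S).
  move=> /(fsubsetP SF) bF /UB [xF _] byy yx.
  suff yF : y \in F by rewrite !inE yF /=; case: asboolP.
  exact: (Fdown.2 x y xF (lt_trans (Fdown.1 _ bF) byy) yx).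
have := density_card_quo A S U Uabove Uclosed.
set P := (X in _ <= #|` X|%:R -> _) => PA.
have cardC : (#|` S| + #|` P| <= #|` F `!` C|)%N.
  rewrite -cardfsUI (_ : S `&` P = fset0)%fset; last first.
    apply/fsetP => x; rewrite [RHS]inE; apply/negP => /fsetIP[].
    by rewrite inE => /andP[_ /asboolP Bx]; rewrite inE => /andP[/UB []].
  rewrite cardfs0 addn0; apply: fsubset_leq_card; apply/fsubsetP => x /fsetUP[].
    by rewrite !inE => /andP[-> /asboolP Bx]; apply/asboolP/BC.
  rewrite inE => /andP[/UB [xF _] /asboolP [b]].
  rewrite !inE xF => /andP[_ /asboolP Bb] Aq; apply/asboolP.
  by rewrite -(quoK b x); exact: ABC.
have SB : density R B * #|` F|%:R <= #|` S|%:R by exact: density_le_card.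
have A1 := density_le1 A.
move: cardC; rewrite -(ler_nat R) natrD; apply: le_trans.
move: SB PA A1; rewrite FU natrD.
move: (density R A) (density R B) (#|` S|%:R) (#|` U|%:R) (#|` P|%:R) => a b s u p.
(* From [p >= a u], [s >= b (s + u)] and [a <= 1] follows [s + p >= (1 - a) s + a (s + u) >= ((1 -
   a) b + a) (s + u)]. *)
by nra.
Qed.

End OneSidedOrder.
End Density.

Theorem theorem3p2 (R : realType) (d : Order.disp_t) (G : porderedGroupType d)
  (hG : right_partially_ordered G \/ left_partially_ordered G)
  (A B : set G) (alpha beta : R)
  (hA : A `<=` positive_cone G) (hB : B `<=` positive_cone G)
  (hAalpha : density R A = alpha) (hBbeta : density R B = beta)
  (hBstar : forall J : set G, downsets G J ->
     forall x : G, (J `\` B) x ->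
       strictly_below B x !=set0 /\ finite_set (strictly_below B x)) :
  (right_partially_ordered G ->
     alpha + beta - alpha * beta <= density R (product_with_one A B)) /\
  (left_partially_ordered G ->
     alpha + beta - alpha * beta <= density R (product_with_one B A)).
Proof.
have Bbelow J (Jd : downsets G J) x (xJ : (J `\` B) x) := (hBstar J Jd x xJ).1.
subst alpha beta; split => ordG.
  (* Translations are injective, so they preserve the strict order too. *)
  have ltM (a b c : G) : (a < b)%O -> (a * c < b * c)%g%O.
    by rewrite !lt_neqAle (inj_eq (mulIg c)) => /andP[-> /ordG ->].
  apply: (@density_op R d G (fun a b => a * b)%g (fun x b => x * b^-1)%g) => //.
  - exact: mulgK.
  - exact: mulgVK.
  - exact: mul1g.
  - by move=> a b c; exact: ltM.
  (* The identity adjoined to [A] puts [B] inside the product set. *)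
  - by move=> b Bb; exists 1%g; [right|exists b; [left|rewrite mul1g]].
  - by move=> a b Aa Bb; exists a; [left|exists b; [left|]].
have ltM (a b c : G) : (a < b)%O -> (c * a < c * b)%g%O.
  by rewrite !lt_neqAle (inj_eq (mulgI c)) => /andP[-> /ordG ->].
(* The factors are swapped so that dividing by [b] is a left translation, which the order now
   respects. *)
apply: (@density_op R d G (fun a b => b * a)%g (fun x b => b^-1 * x)%g) => //.
- exact: mulKg.
- exact: mulVKg.
- exact: mulg1.
- by move=> a b c; exact: ltM.
- by move=> b Bb; exists b; [left|exists 1%g; [right|rewrite mulg1]].
- by move=> a b Aa Bb; exists b; [left|exists a; [left|]].
Qed.
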